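(* Consider the relatively free algebra $F_n(\mathfrak{N}_p)$ of rank $n$ in the variety $\mathfrak{N}_p$, for arbitrary positive integers $p$ and $n$, over a field $K$ of characteristic zero. Then the following hold: (i) If one of $n$ and $p$ is odd and the other one is even, then $g=[x_1,x_2]\cdots[x_{n+p-4},x_{n+p-3}]$ is not a polynomial identity for $F_n(\mathfrak{N}_p)$. (ii) If both $n$ and $p$ are odd, then $g=[x_1,x_2]\cdots[x_{n+p-5},x_{n+p-4}]$ is not an identity for $F_n(\mathfrak{N}_p)$. (iii) If both $n$ and $p$ are even, then $g=[x_1,x_2]\cdots[x_{n+p-3},x_{n+p-2}]$ is not an identity for $F_n(\mathfrak{N}_p)$.
   Context: All algebras are associative and unitary over a field $K$ of characteristic zero. $K\langle X\rangle$ is the free unitary associative algebra on $X=\{x_1,x_2,\dots\}$. Commutators are left-normed: $[a,b]=ab-ba$ and $[a_1,\dots,a_{m}]=[[a_1,\dots,a_{m-1}],a_m]$ for $m\ge 3$. For a positive integer $p$, $\mathfrak{N}_p$ is the variety of algebras satisfying $[x_1,\dots,x_{p+1}]=0$ (Lie nilpotent associative algebras of index $p$). $I_{p+1}$ is the two-sided ideal of $K\langle X\rangle$ generated by all commutators $[u_1,\dots,u_{p+1}]$ of length $p+1$, $u_i\in K\langle X\rangle$, and $F_n(\mathfrak{N}_p)=K\langle x_1,\dots,x_n\rangle/(I_{p+1}\cap K\langle x_1,\dots,x_n\rangle)$. A polynomial $f(x_1,\dots,x_m)\in K\langle X\rangle$ is a (polynomial) identity for an algebra $A$ if $f(a_1,\dots,a_m)=0$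 for all $a_i\in A$. Each displayed polynomial $g$ is the product of the commutators $[x_{2i-1},x_{2i}]$ of consecutive variables, up to the last one shown.
   Formalization: The cases n = 1 with p ≥ 4 and p = 1 with n ≥ 4 are excluded: there F_n(N_p) is commutative and g has at least one commutator factor, so g is an identity and the claim fails; when the last index of g is at most 0, g is read as the empty product 1. *)

(* Defs.v *)
From HB Require Import structures.
From mathcomp Require Import all_boot all_order all_algebra ring_quotient.
From mathcomp Require Import generic_quotient finmap.
From mathcomp.multinomials Require Import monalg.
From mathcomp Require Import boolp.

Set Implicit Arguments.
Unset Strict Implicit.
Unset Printing Implicit Defensive.

Import GRing.Theory.
Local Open Scope ring_scope.

(* The unitary free associative algebra on the set of letters I: the monoid   *)
(* algebra of the free monoid on I.                                           *)
Definition freeAlg (K : fieldType) (I : choiceType) : Type := {malg K[{fmonom I}]}.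

Section FreeAlgebra.
Variables (K : fieldType) (I : choiceType).

HB.instance Definition _ := GRing.Lalgebra.on (freeAlg K I).

(* monalg only provides the algType structure over commutative monoids.       *)
Fact freeAlg_scalerAr (c : K) (f g : freeAlg K I) : c *: (f * g) = f * (c *: g).
Proof.
apply/malgP=> k; rewrite mcoeffZ mcoeffMl.
rewrite (mcoeffMlw _ (fsubset_refl _) (msuppZ_le c g)) mulr_sumr.
apply: eq_bigr => k1 _; rewrite mulr_sumr; apply: eq_bigr => k2 _.
by rewrite mcoeffZ mulrnAr mulrCA.
Qed.
HB.instance Definition _ :=
  GRing.Lalgebra_isAlgebra.Build K (freeAlg K I) freeAlg_scalerAr.

Definition fvar (i : I) : freeAlg K I := << fmu i >>.

Section Evaluation.
Variables (A : algType K) (a : I -> A).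

Definition evalm (w : {fmonom I}) : A := \prod_(i <- (w : seq I)) a i.

Fact evalm_is_mmorphism : mmorphism evalm.
Proof. by split=> [v w|]; rewrite /evalm ?fmM ?big_cat // fm1 big_nil. Qed.
HB.instance Definition _ := isMultiplicative.Build _ _ evalm evalm_is_mmorphism.

(* The substitution f |-> f(a).                                               *)
Definition eval (f : freeAlg K I) : A := mmap (GRing.in_alg A) evalm f.

Fact eval_is_zmod_morphism : zmod_morphism eval.
Proof. exact: mmap_is_additive. Qed.
HB.instance Definition _ :=
  GRing.isZmodMorphism.Build (freeAlg K I) A eval eval_is_zmod_morphism.

Fact eval_is_monoid_morphism : monoid_morphism eval.
Proof.
have [|evM ev1] := @commr_mmap_is_multiplicative _ _ _ (GRing.in_alg A) evalm.
  by move=> g m m'; rewrite /GRing.comm /= -scalerAl mul1r -scalerAr mulr1.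
by split.
Qed.
HB.instance Definition _ :=
  GRing.isMonoidMorphism.Build (freeAlg K I) A eval eval_is_monoid_morphism.

End Evaluation.
End FreeAlgebra.

(* K<X> for X = {x_1, x_2, ...}; the variable x_(i.+1) is fvar K i.           *)
Notation freeX K := (freeAlg K nat).

Definition is_identity (K : fieldType) (A : algType K) (f : freeX K) : Prop :=
  forall a : nat -> A, eval a f = 0.

Definition lie (A : nzRingType) (a b : A) : A := a * b - b * a.

(* The left-normed commutator [a, s_1, ..., s_k].                             *)
Definition lie_left (A : nzRingType) (a : A) (s : seq A) : A :=
  foldl (@lie A) a s.

Definition two_sided_ideal (A : nzRingType) (J : A -> Prop) : Prop :=
  [/\ J 0, forall x y, J x -> J y -> J (x - y),
      forall a x, J x -> J (a * x) & forall a x, J x -> J (x * a)].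

Definition ideal_gen (A : nzRingType) (S : A -> Prop) (x : A) : Prop :=
  forall J, two_sided_ideal J -> (forall s, S s -> J s) -> J x.

(* commutator_ideal K q is the ideal I_q: u :: s has length q.                *)
Definition commutator_ideal (K : fieldType) (q : nat) : freeX K -> Prop :=
  ideal_gen (fun f => exists u (s : seq (freeX K)),
    (size s).+1 = q /\ f = lie_left u s).

(* The quotient of an algebra by a two-sided ideal; the ideal is required to  *)
(* be proper because an algType is nonzero.                                   *)
Record properIdeal (A : nzRingType) := ProperIdeal {
  pideal :> A -> Prop;
  pideal_ideal : two_sided_ideal pideal;
  pideal_neq1 : ~ pideal 1
}.

Definition in_pideal (A : nzRingType) (J : properIdeal A) : {pred A} :=
  fun x => `[< J x >].

Section IdealPred.
Variables (A : nzRingType) (J : properIdeal A).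

Fact in_pideal_zmod_closed : zmod_closed (in_pideal J).
Proof.
have [J0 JB _ _] := pideal_ideal J.
split=> [|x y /asboolP Jx /asboolP Jy]; first exact/asboolP.
by apply/asboolP/JB.
Qed.
HB.instance Definition _ :=
  GRing.isZmodClosed.Build A (in_pideal J) in_pideal_zmod_closed.

Definition quotAlg : Type := Quotient.quot (in_pideal J).

HB.instance Definition _ := GRing.Zmodule.on quotAlg.
HB.instance Definition _ := EqQuotient.on quotAlg.

End IdealPred.

Section QuotientAlgebra.
Local Open Scope quotient_scope.
Variables (K : fieldType) (A : algType K) (J : properIdeal A).
Local Notation Q := (quotAlg J).

Definition quot_pi (x : A) : Q := \pi_(Quotient.quot (in_pideal J)) x.

Lemma quot_pi_surj (u : Q) : exists x, u = quot_pi x.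
Proof. by exists (repr u); rewrite /quot_pi reprK. Qed.

Lemma quot_pi_eq (x y : A) : quot_pi x = quot_pi y <-> J (x - y).
Proof.
split=> [/eqP|Jxy]; first by rewrite -Quotient.idealrBE => /asboolP.
by apply/eqP; rewrite -Quotient.idealrBE; apply/asboolP.
Qed.

Fact quot_pi_is_zmod_morphism : zmod_morphism quot_pi.
Proof. by move=> x y; rewrite /quot_pi !piE. Qed.
HB.instance Definition _ :=
  GRing.isZmodMorphism.Build A Q quot_pi quot_pi_is_zmod_morphism.

Lemma quot_pi_repr (x : A) : J (repr (quot_pi x) - x).
Proof. by apply/quot_pi_eq; rewrite {1}/quot_pi reprK. Qed.

(* Locked: unfolding the monoid algebra makes conversion very slow.           *)
Fact quot_key : unit. Proof. by []. Qed.
Definition quot_mul : Q -> Q -> Q :=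
  locked_with quot_key (fun u v => quot_pi (repr u * repr v)).
Definition quot_scale : K -> Q -> Q :=
  locked_with quot_key (fun c u => quot_pi (c *: repr u)).

Lemma quot_piM (x y : A) : quot_pi (x * y) = quot_mul (quot_pi x) (quot_pi y).
Proof.
have [J0 JB Jl Jr] := pideal_ideal J.
rewrite /quot_mul unlock; apply/quot_pi_eq.
have -> : x * y - repr (quot_pi x) * repr (quot_pi y) =
    x * (y - repr (quot_pi y)) - (repr (quot_pi x) - x) * repr (quot_pi y).
  by rewrite mulrBr mulrBl opprB addrA subrK.
apply: (JB); last exact/Jr/quot_pi_repr.
by apply: Jl; rewrite -opprB -[- _]add0r; apply: JB => //; apply: quot_pi_repr.
Qed.

Lemma quot_piZ (c : K) (x : A) : quot_pi (c *: x) = quot_scale c (quot_pi x).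
Proof.
have [J0 JB Jl Jr] := pideal_ideal J.
rewrite /quot_scale unlock; apply/quot_pi_eq; rewrite -scalerBr -[_ - _]mul1r scalerAl; apply: Jl.
by rewrite -opprB -[- _]add0r; apply: JB => //; apply: quot_pi_repr.
Qed.

Fact quot_mulA : associative quot_mul.
Proof.
move=> u v w; have [x ->] := quot_pi_surj u; have [y ->] := quot_pi_surj v.
by have [z ->] := quot_pi_surj w; rewrite -!quot_piM mulrA.
Qed.

Fact quot_mul1 : left_id (quot_pi 1) quot_mul.
Proof. by move=> u; have [x ->] := quot_pi_surj u; rewrite -quot_piM mul1r. Qed.

Fact quot_1mul : right_id (quot_pi 1) quot_mul.
Proof. by move=> u; have [x ->] := quot_pi_surj u; rewrite -quot_piM mulr1. Qed.

Fact quot_mulDl : left_distributive quot_mul +%R.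
Proof.
move=> u v w; have [x ->] := quot_pi_surj u; have [y ->] := quot_pi_surj v.
have [z ->] := quot_pi_surj w.
by rewrite -raddfD -!quot_piM -raddfD /= mulrDl.
Qed.

Fact quot_mulDr : right_distributive quot_mul +%R.
Proof.
move=> u v w; have [x ->] := quot_pi_surj u; have [y ->] := quot_pi_surj v.
have [z ->] := quot_pi_surj w.
by rewrite -raddfD -!quot_piM -raddfD /= mulrDr.
Qed.

Fact quot_1neq0 : quot_pi 1 != 0.
Proof.
apply/eqP; rewrite -(raddf0 quot_pi) => /quot_pi_eq; rewrite subr0.
exact: pideal_neq1.
Qed.

HB.instance Definition _ := GRing.Zmodule_isNzRing.Build Q
  quot_mulA quot_mul1 quot_1mul quot_mulDl quot_mulDr quot_1neq0.

Fact quot_scaleA (b c : K) (u : Q) :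
  quot_scale b (quot_scale c u) = quot_scale (b * c) u.
Proof. by have [x ->] := quot_pi_surj u; rewrite -!quot_piZ scalerA. Qed.

Fact quot_scale1 : left_id 1 quot_scale.
Proof. by move=> u; have [x ->] := quot_pi_surj u; rewrite -quot_piZ scale1r. Qed.

Fact quot_scaleDr : right_distributive quot_scale +%R.
Proof.
move=> c u v; have [x ->] := quot_pi_surj u; have [y ->] := quot_pi_surj v.
by rewrite -raddfD -!quot_piZ -raddfD /= scalerDr.
Qed.

Fact quot_scaleDl (u : Q) : {morph quot_scale^~ u : b c / b + c}.
Proof.
move=> b c; have [x ->] := quot_pi_surj u.
by rewrite -!quot_piZ -raddfD /= scalerDl.
Qed.

HB.instance Definition _ := GRing.Zmodule_isLmodule.Build K Q
  quot_scaleA quot_scale1 quot_scaleDr quot_scaleDl.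

Fact quot_scaleAl (c : K) (u v : Q) : c *: (u * v) = (c *: u) * v.
Proof.
have [x ->] := quot_pi_surj u; have [y ->] := quot_pi_surj v.
change (quot_scale c (quot_mul (quot_pi x) (quot_pi y)) =
  quot_mul (quot_scale c (quot_pi x)) (quot_pi y)).
by rewrite -quot_piZ -!quot_piM -quot_piZ scalerAl.
Qed.
HB.instance Definition _ := GRing.Lmodule_isLalgebra.Build K Q quot_scaleAl.

Fact quot_scaleAr (c : K) (u v : Q) : c *: (u * v) = u * (c *: v).
Proof.
have [x ->] := quot_pi_surj u; have [y ->] := quot_pi_surj v.
change (quot_scale c (quot_mul (quot_pi x) (quot_pi y)) =
  quot_mul (quot_pi x) (quot_scale c (quot_pi y))).
by rewrite -quot_piZ -!quot_piM -quot_piZ scalerAr.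
Qed.
HB.instance Definition _ := GRing.Lalgebra_isAlgebra.Build K Q quot_scaleAr.

Fact quot_pi_is_monoid_morphism : monoid_morphism quot_pi.
Proof. by split=> // x y; exact: quot_piM. Qed.
HB.instance Definition _ :=
  GRing.isMonoidMorphism.Build A Q quot_pi quot_pi_is_monoid_morphism.

End QuotientAlgebra.

Section RelativelyFree.
Variables (K : fieldType) (n p : nat).

(* K<x_1, ..., x_n> is represented by the free algebra on 'I_n, embedded in   *)
(* K<X> by sending the i-th letter to the i-th variable.                      *)
Definition freeAlg_incl : freeAlg K 'I_n -> freeX K :=
  eval (fun i : 'I_n => fvar K (i : nat)).

(* I_(p+1) \cap K<x_1, ..., x_n>.                                             *)
Definition relfree_ideal (f : freeAlg K 'I_n) : Prop :=
  commutator_ideal p.+1 (freeAlg_incl f).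

Fact relfree_ideal_ideal : two_sided_ideal relfree_ideal.
Proof.
rewrite /relfree_ideal /freeAlg_incl; split=> [|x y Jx Jy|a x Jx|a x Jx] J JJ JS;
have [J0 JB Jl Jr] := JJ.
- by rewrite rmorph0.
- by rewrite rmorphB; apply: JB; [apply: Jx|apply: Jy].
- by rewrite rmorphM; apply: Jl; apply: Jx.
- by rewrite rmorphM; apply: Jr; apply: Jx.
Qed.

(* Commutators of length at least 2 vanish under x_i |-> 0.                   *)
Fact relfree_ideal_neq1 : (0 < p)%N -> ~ relfree_ideal 1.
Proof.
rewrite /relfree_ideal /freeAlg_incl rmorph1 => p_gt0 I1.
pose aug : freeX K -> K^o := eval (fun=> 0).
suff: aug 1 = 0 by rewrite /aug rmorph1 => /eqP; rewrite oner_eq0.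
have lie0 x y : aug (lie x y) = 0.
  by rewrite /aug /lie rmorphB !rmorphM [X in _ - X]mulrC subrr.
apply: (I1 (fun f => aug f = 0)) => [|f [u [s [[sz_s] ->]]]].
  rewrite /aug; split=> [|x y Jx Jy|a x Jx|a x Jx]; first by rewrite rmorph0.
  - by rewrite rmorphB /= Jx Jy subr0.
  - by rewrite rmorphM /= Jx mulr0.
  - by rewrite rmorphM /= Jx mul0r.
case/lastP: s sz_s => [|s v _]; first by move=> sz0; rewrite -sz0 in p_gt0.
by rewrite /lie_left -cats1 foldl_cat; apply: lie0.
Qed.

Definition relfree_pideal (p_gt0 : (0 < p)%N) : properIdeal (freeAlg K 'I_n) :=
  ProperIdeal relfree_ideal_ideal (relfree_ideal_neq1 p_gt0).

(* F_n(N_p), for p positive. It is commutative when n = 1 or p = 1, so that   *)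
(* every product of commutators with at least one factor is then an identity. *)
Definition relfree (p_gt0 : (0 < p)%N) : algType K :=
  quotAlg (relfree_pideal p_gt0).

End RelativelyFree.

(* [x_1, x_2] [x_3, x_4] ... [x_(d-1), x_d], for d even; it is 1 when d = 0.  *)
Definition comm_prod (K : fieldType) (d : nat) : freeX K :=
  \prod_(i < d./2) lie (fvar K i.*2) (fvar K i.*2.+1).

(* Main.v *)
Require Import Defs.
From mathcomp Require Import all_boot all_order all_algebra.
From mathcomp Require Import monalg zify.

(** Everything happens inside one concrete algebra.  Let E_k be the Grassmann
    algebra on k generators, and let A be the tensor product of E_(2q) with m
    copies of E_2.  Its generators (letters) fall into m + 1 colours, one for
    each tensor factor: two letters of the same colour anticommute, two letters
    of different colours commute, and squares of letters vanish.

    A is Lie nilpotent: left-normed commutators of length 2m + 3 vanish.  Two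
    words in the letters commute up to the sign (-1)^c, where c sums over the
    colours the product of the numbers of letters of that colour.  So a
    commutator of words is 0 or twice their concatenation, and it is nonzero
    only when some colour occurs an odd number of times in both words.  If this
    colour is one of the m small ones, both of its letters are now used up,
    which can happen m times; if it is the large colour, its number of
    occurrences becomes even, and it takes a small colour to get on from there.
    The two kinds of steps must thus essentially alternate, whence the bound
    (deep_step, lie_left_eq0).

    On the other hand some 2q elements of A keep a long product of commutators
    alive.  The first two are sums of m + 1 letters, one for each colour, whose
    commutator is a sum Y_0 + ... + Y_m of commuting elements of square zero,
    Y_j being twice the product of two letters of colour j.  Its power of
    exponent m + 1 is (m + 1)! Y_0 ... Y_m, which is not cancelled in
    characteristic zero.  The remaining elements are letters of the large
    colour, which form q - 1 further commutators.  The product of the q + m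
    commutators is a nonzero multiple of the product of all letters
    (point_comm_prod).

    When 2q <= n and 2m + 2 <= p, evaluation in A kills I_(p+1), so a product of
    q + m commutators is not an identity of F_n(N_p); only the relations between
    the letters and the nonvanishing of their product matter, so that A may be
    replaced by an algebra of matrices with these properties (colour_algebra).
    Taking q and m + 1 to be the integer parts of n/2 and p/2 gives 2(q + m) = n
    + p - 2, n + p - 3 or n + p - 4 according to the parities. When n = 1 or p =
    1, the bound assumed on the other parameter leaves only the empty product g
    = 1. *)

Set Implicit Arguments.
Unset Strict Implicit.
Unset Printing Implicit Defensive.

Import GRing.Theory.
Local Open Scope ring_scope.

(** * Linear combinations of words *)

Section Words.
Variables (K : fieldType) (A : algType K) (I : eqType) (g : I -> A).

Definition word (w : seq I) : A := \prod_(i <- w) g i.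

Lemma word_cat v w : word (v ++ w) = word v * word w.
Proof. exact: big_cat. Qed.

(** Linear combinations of the words selected by [P].  Restricting the words is
    what records how far a commutator has already been pushed. *)
Inductive spanned (P : pred (seq I)) : A -> Prop :=
| Spanned0 : spanned P 0
| SpannedD c w u : P w -> spanned P u -> spanned P (c *: word w + u).

Lemma spanned_add P u v : spanned P u -> spanned P v -> spanned P (u + v).
Proof.
move=> Pu Pv; elim: Pu => [|c w u' Pw _ IH]; first by rewrite add0r.
by rewrite -addrA; apply: SpannedD.
Qed.

Lemma spanned_scale P c u : spanned P u -> spanned P (c *: u).
Proof.
elim=> [|d w v Pw _ IH]; first by rewrite scaler0; apply: Spanned0.
by rewrite scalerDr scalerA; apply: SpannedD.
Qed.

Lemma spanned_word (P : pred (seq I)) w : P w -> spanned P (word w).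
Proof. by move=> Pw; rewrite -[word w]addr0 -[word w]scale1r; do 2?constructor. Qed.

Lemma spanned_sum P (T : Type) (r : seq T) (F : T -> A) :
  (forall x, spanned P (F x)) -> spanned P (\sum_(x <- r) F x).
Proof.
move=> PF; elim/big_ind: _ => // [|u v]; first exact: Spanned0.
exact: spanned_add.
Qed.

(** Words of value 0 can be dropped, so conditions satisfied by all nonzero
    words, such as having distinct letters, come for free. *)
Lemma spanned_sub (P Q : pred (seq I)) u :
  (forall w, P w -> word w != 0 -> Q w) -> spanned P u -> spanned Q u.
Proof.
move=> PQ; elim=> [|c w v Pw _ IH]; first exact: Spanned0.
have [->|w_neq0] := eqVneq (word w) 0; first by rewrite scaler0 add0r.
by apply: SpannedD => //; apply: PQ.
Qed.

Lemma spanned_mul u v : spanned predT u -> spanned predT v -> spanned predT (u * v).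
Proof.
move=> Pu Pv; elim: Pu => [|c w u' _ _ IH]; first by rewrite mul0r; constructor.
rewrite mulrDl -scalerAl; apply: spanned_add => //; apply: spanned_scale.
elim: Pv => [|d w' v' _ _ IHv]; first by rewrite mulr0; constructor.
by rewrite mulrDr -scalerAr -word_cat; apply: SpannedD.
Qed.

Lemma spanned_prod (T : Type) (r : seq T) (F : T -> A) :
  (forall x, spanned predT (F x)) -> spanned predT (\prod_(x <- r) F x).
Proof.
move=> PF; elim/big_ind: _ => // [|u v]; last by apply: spanned_mul.
by rewrite -(big_nil 1 *%R xpredT g); apply: spanned_word.
Qed.

Lemma spanned_lie (P Q : pred (seq I)) u v :
    (forall x y, P x -> spanned Q (lie (word x) (word y))) ->
  spanned P u -> spanned predT v -> spanned Q (lie u v).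
Proof.
move=> PQ Pu Pv; elim: Pu => [|c x u' Px _ IH].
  by rewrite /lie mul0r mulr0 subr0; constructor.
have -> : lie (c *: word x + u') v = c *: lie (word x) v + lie u' v.
  by rewrite /lie mulrDl mulrDr opprD addrACA scalerBr scalerAl scalerAr.
apply: spanned_add => //; apply: spanned_scale.
elim: Pv => [|d y v' _ _ IHv]; first by rewrite /lie mul0r mulr0 subr0; constructor.
have -> : lie (word x) (d *: word y + v') = d *: lie (word x) (word y) + lie (word x) v'.
  by rewrite /lie mulrDl mulrDr opprD addrACA -scalerAr -scalerAl -scalerBr.
by apply: spanned_add => //; apply: spanned_scale; apply: PQ.
Qed.

End Words.

(** * Lie nilpotency of colour-commutative algebras *)

Section ColourCommutative.
Variables (K : fieldType) (A : algType K) (I : eqType) (C : finType).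
Variables (g : I -> A) (cls : I -> C) (c0 : C).
Hypothesis two_unit : 2%:R != 0 :> K.
Hypothesis g_comm : forall i j, g i * g j = (-1) ^+ (cls i == cls j) * (g j * g i).
Hypothesis few : forall (c : C) (w : seq I),
  c != c0 -> uniq w -> (count (fun i => cls i == c) w <= 2)%N.

Local Notation cnt c w := (count (fun i => cls i == c) w).

(** The number of sign changes needed to move the word [v] across [w]. *)
Definition crossings (v w : seq I) : nat := \sum_(c : C) cnt c v * cnt c w.

Lemma word_comm1 i w :
  g i * word g w = (-1) ^+ cnt (cls i) w * (word g w * g i).
Proof.
elim: w => [|j w IH]; first by rewrite /word big_nil /= mulr1 !mul1r.
rewrite /word big_cons -/(word g w) mulrA g_comm -!mulrA IH /=.
rewrite [in RHS]exprD [cls j == _]eq_sym -!mulrA; congr (_ * _).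
by rewrite !mulrA; congr (_ * _ * _); rewrite -signr_odd commr_sign.
Qed.

Lemma word_comm v w :
  word g v * word g w = (-1) ^+ crossings v w * (word g w * word g v).
Proof.
elim: v => [|i v IH].
  by rewrite /word big_nil mul1r mulr1 /crossings [X in _ ^+ X]big1 // mul1r.
have -> : crossings (i :: v) w = (crossings v w + cnt (cls i) w)%N.
  rewrite /crossings (eq_bigr (fun c => (cls i == c) * cnt c w + cnt c v * cnt c w)%N).
    rewrite big_split /= addnC; congr (_ + _)%N.
    rewrite (bigD1 (cls i)) //= eqxx mul1n big1 ?addn0 // => c.
    by rewrite eq_sym => /negPf->.
  by move=> c _; rewrite -mulnDl.
rewrite /word big_cons -/(word g v) -mulrA IH exprD -!mulrA.
rewrite -(signr_odd _ (crossings v w)) [LHS]mulrA commr_sign -!mulrA; congr (_ * _).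
by rewrite mulrA word_comm1 -!mulrA.
Qed.

Lemma lie_words v w :
  lie (word g v) (word g w) = (odd (crossings v w))%:R *: (2%:R *: word g (v ++ w)).
Proof.
rewrite /lie word_cat [word g w * _]word_comm.
have -> : crossings w v = crossings v w by apply: eq_bigr => c _; rewrite mulnC.
rewrite -signr_odd; case: odd => /=; last by rewrite expr0 mul1r subrr scale0r.
by rewrite expr1 mulN1r opprK scale1r scaler_nat.
Qed.

(** An equal pair of letters can be brought side by side at the cost of a sign,
    and a letter anticommutes with itself. *)
Lemma word_nonuniq w : ~~ uniq w -> word g w = 0.
Proof.
elim: w => //= i w IH; rewrite negb_and negbK => /orP[|/IH w0]; last first.
  by rewrite /word big_cons -/(word g w) w0 mulr0.
case/splitPr=> w1 w2; rewrite -cat1s !word_cat -(cat1s i w2) !word_cat.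
have gi : word g [:: i] = g i by rewrite /word big_seq1.
rewrite gi mulrA word_comm1 -!mulrA (mulrA (g i)).
suff -> : g i * g i = 0 by rewrite mul0r !mulr0.
move: (g_comm i i); rewrite eqxx expr1 mulN1r => /eqP.
rewrite -addr_eq0 -mulr2n -scaler_nat scaler_eq0 (negPf two_unit) /=.
by move/eqP.
Qed.

(** The colours other than [c0], called small, that are used up: a nonzero word
    has at most two letters of a small colour. *)
Definition saturated (w : seq I) : {set C} := [set c | c != c0 & (1 < cnt c w)%N].

(** An invariant of the nonzero words occurring in a commutator of length [k].
    A commutation either saturates a small colour or makes the number of letters
    of colour [c0] even; the latter cannot happen twice in a row, so every small
    colour pays for two commutations. *)
Definition deep (k : nat) (w : seq I) : bool :=
  uniq w && (k <= #|saturated w|.*2.+1 + ~~ odd (cnt c0 w))%N.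

(** Some colour [c] occurs oddly in both words.  If [c != c0], it occurs exactly
    once in [v] and becomes saturated, which raises the bound by 2, enough to
    make up for a possible loss of 1 at [c0].  If [c = c0], the number of letters
    of colour [c0] passes from odd to even, which raises the bound by 1. *)
Lemma deep_step k v w : deep k v -> uniq (v ++ w) -> odd (crossings v w) ->
  deep k.+1 (v ++ w).
Proof.
case/andP=> uv kv uvw oddvw; rewrite /deep uvw /=.
have sub : saturated v \subset saturated (v ++ w).
  apply/subsetP=> c; rewrite !inE count_cat => /andP[-> /leq_trans->//].
  exact: leq_addr.
have [/existsP[c /andP[c_neq0]]|] :=
    boolP [exists c, (c != c0) && odd (cnt c v * cnt c w)].
  rewrite oddM => /andP[ov ow].
  have : (#|saturated v| < #|saturated (v ++ w)|)%N.
    apply: proper_card; rewrite properE sub; apply/subsetPn; exists c.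
      by rewrite inE c_neq0 count_cat; lia.
    rewrite inE c_neq0; have := few c_neq0 uv; lia.
  by move: kv; case: odd; case: odd; lia.
rewrite negb_exists => /forallP noc.
have : odd (cnt c0 v * cnt c0 w).
  move: oddvw; rewrite /crossings (bigD1 c0) //= oddD.
  suff /negPf-> : ~~ odd (\sum_(i | i != c0) cnt i v * cnt i w) by rewrite addbF.
  elim/big_ind: _ => // [x y|c c_neq0]; first by rewrite oddD => /negPf-> /negPf->.
  by have := noc c; rewrite c_neq0.
rewrite oddM count_cat oddD => /andP[ov ow].
by move: kv (subset_leq_card sub); rewrite ov ow /=; lia.
Qed.

(** The colour [c0] is never counted as saturated, so the bound in [deep] cannot
    exceed [2 * #|C|], whereas the commutator has length [1 + size s]. *)
Lemma lie_left_eq0 u s : (#|C|.*2 <= size s)%N ->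
    spanned g predT u -> (forall v, v \in s -> spanned g predT v) ->
  lie_left u s = 0.
Proof.
move=> sz Pu Ps.
have start : spanned g (deep 1) u.
  apply: spanned_sub Pu => w _ w0; apply/andP; split; last by [].
  by apply: contraNT w0 => /word_nonuniq->.
have : spanned g (deep (1 + size s)) (lie_left u s).
  elim: s 1%N u {Pu sz} start Ps => [|v s IH] k u Pu Ps; first by rewrite addn0.
  rewrite /lie_left /= -addSnnS; apply: IH; last first.
    by move=> y ys; apply: Ps; rewrite inE ys orbT.
  apply: spanned_lie Pu (Ps v (mem_head _ _)) => x y dx.
  rewrite lie_words; case: (boolP (odd _)) => oxy; last by rewrite scale0r; constructor.
  rewrite scale1r; apply: spanned_scale.
  have [uxy|/word_nonuniq->] := boolP (uniq (x ++ y)).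
    by apply: spanned_word; apply: deep_step.
  exact: Spanned0.
case=> // c w v /andP[uw dw].
have : (#|saturated w| < #|C|)%N.
  rewrite -cardsT; apply: proper_card; rewrite properE subsetT.
  by apply/subsetPn; exists c0; rewrite ?inE ?eqxx.
by move: dw; case: odd; lia.
Qed.

End ColourCommutative.

(** * Powers of sums of commuting elements of square zero *)

Section SquareZeroSums.
Variable R : nzRingType.

Lemma exprD_sq0 (x y : R) k : x * y = y * x -> x * x = 0 ->
  (x + y) ^+ k.+1 = y ^+ k.+1 + x * y ^+ k *+ k.+1.
Proof.
move=> xy xx; elim: k => [|k IH]; first by rewrite !expr1 expr0 mulr1 addrC.
rewrite exprS IH mulrDl !mulrDr !mulrnAr (mulrA x x) xx mul0r mul0rn addr0.
by rewrite (mulrA y x) -xy -(mulrA x y) -!exprS addrCA -mulrS.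
Qed.

(** In the multinomial expansion only the terms with distinct factors survive.
    The vanishing of the next power is what makes the induction work. *)
Lemma sum_sq0_expr (s : seq R) :
    {in s &, forall x y, x * y = y * x} -> {in s, forall x, x * x = 0} ->
  (\sum_(x <- s) x) ^+ size s = (\prod_(x <- s) x) *+ (size s)`!
  /\ (\sum_(x <- s) x) ^+ (size s).+1 = 0.
Proof.
elim: s => [|z s IH] scomm sq0; first by rewrite !big_nil expr0 expr1.
have [||IH1 IH2] := IH.
- by move=> x y xs ys; apply: scomm; rewrite inE ?xs ?ys orbT.
- by move=> x xs; apply: sq0; rewrite inE xs orbT.
rewrite !big_cons /=; set S := \sum_(x <- s) x in IH1 IH2 *.
have zS : z * S = S * z.
  rewrite /S mulr_sumr mulr_suml; apply: eq_big_seq => x xs.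
  by apply: scomm; rewrite ?mem_head // inE xs orbT.
have zz : z * z = 0 by apply: sq0; apply: mem_head.
rewrite !exprD_sq0 // (exprS S _.+1) IH2 !mulr0 !add0r IH1 mul0rn; split=> //.
by rewrite mulrnAr -mulrnA mulnC factS.
Qed.

End SquareZeroSums.

(** * Existence of colour-commutative algebras *)

Section Matrices.
Variable (K : fieldType).

(** As for the spin matrices of Jordan and Wigner, a new letter is adjoined by
    doubling the size: old letters act diagonally by blocks, and the new letter
    is an off-diagonal block.  The signs between the new letter and the old ones
    come from this block, an operator [D c] that commutes with each letter [i]
    up to the sign [c i]; such operators are carried along in the induction.
    They are involutions, which keeps the product of the letters nonzero. *)
Lemma colour_matrices (e : nat -> nat -> bool) N : (forall i j, e i j = e j i) ->
  exists M (g : nat -> 'M[K]_M) (D : (nat -> bool) -> 'M[K]_M),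
  [/\ forall i j, g i *m g j = (-1) ^+ e i j *: (g j *m g i),
      forall c i, D c *m g i = (-1) ^+ c i *: (g i *m D c),
      forall c d, D c *m D d = D d *m D c,
      forall c, D c *m D c = 1%:M
    & \prod_(i < N) g i != 0].
Proof.
move=> e_sym; elim: N => [|N [M [g [D [gg Dg DD D1 g_neq0]]]]].
  exists 1%N, (fun=> 0), (fun=> 1%:M); split=> *; rewrite ?mulmx0 ?mul0mx ?scaler0 //.
    by rewrite mulmx1.
  by rewrite big_ord0 oner_neq0.
pose h i := if i == N then block_mx 0 0 (D (e N)) 0 else block_mx (g i) 0 0 (g i).
pose H c := block_mx (D c) 0 0 ((-1) ^+ c N *: D c).
have sgn2 (b : bool) : (-1) ^+ b * (-1) ^+ b = 1 :> K by rewrite -expr2 sqrr_sign.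
exists (M + M)%N, h, H; split=> [i j|c i|c d|c|].
- rewrite /h; have [->|iN] := eqVneq i N; have [->|jN] := eqVneq j N;
    rewrite !mulmx_block !(mulmx0, mul0mx, addr0, add0r) scale_block_mx !scaler0 //.
  + by rewrite Dg.
  + by rewrite Dg e_sym scalerA sgn2 scale1r.
  + by rewrite gg.
- rewrite /h /H; have [->|iN] := eqVneq i N;
    rewrite !mulmx_block !(mulmx0, mul0mx, addr0, add0r) scale_block_mx !scaler0 //.
  + by rewrite -scalemxAl DD.
  + by rewrite Dg -scalemxAl -scalemxAr Dg !scalerA mulrC.
- rewrite /H !mulmx_block !(mulmx0, mul0mx, addr0, add0r).
  by rewrite -!scalemxAl -!scalemxAr DD !scalerA mulrC.
- rewrite /H !mulmx_block !(mulmx0, mul0mx, addr0, add0r).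
  by rewrite -!scalemxAl -!scalemxAr D1 !scalerA sgn2 scale1r -scalar_mx_block.
have -> : \prod_(i < N.+1) h i =
    block_mx 0 0 (\prod_(i < N) g i *m D (e N)) 0.
  rewrite big_ord_recr /= {2}/h eqxx.
  have -> : \prod_(i < N) h i = block_mx (\prod_(i < N) g i) 0 0 (\prod_(i < N) g i).
    rewrite (eq_bigr (fun i : 'I_N => block_mx (g i) 0 0 (g i))); last first.
      by move=> i _; rewrite /h ltn_eqF.
    elim/big_rec2: _ => [|i x y _ ->]; first by rewrite -scalar_mx_block.
    by rewrite -[LHS]/(_ *m _) mulmx_block !(mulmx0, mul0mx, addr0, add0r).
  by rewrite -[LHS]/(_ *m _) mulmx_block !(mulmx0, mul0mx, addr0, add0r).
apply: contraNneq g_neq0 => /(congr1 dlsubmx).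
rewrite block_mxKdl => P0; rewrite -[X in X == _]mulmx1 -(D1 (e N)) mulmxA P0.
by rewrite -[X in dlsubmx X]block_mx0 block_mxKdl mul0mx.
Qed.

Lemma colour_algebra (e : nat -> nat -> bool) N : (forall i j, e i j = e j i) ->
  exists (A : algType K) (g : nat -> A),
    (forall i j, g i * g j = (-1) ^+ e i j * (g j * g i)) /\ \prod_(i < N) g i != 0.
Proof.
case/(@colour_matrices e N) => [[|M] [g [D [gg _ _ _ g_neq0]]]].
  by case/eqP: g_neq0; apply/matrixP=> -[].
exists ('M[K]_M.+1 : algType K), g; split=> // i j.
by rewrite [LHS]gg; case: (e i j); rewrite ?scaleN1r ?mulN1r ?scale1r ?mul1r.
Qed.

End Matrices.

(** * Evaluation and identities of relatively free algebras *)

Section Evaluation.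
Variables (K : fieldType) (A : algType K).

Lemma eval_fvar (I : choiceType) (a : I -> A) i : eval a (fvar K i) = a i.
Proof. by rewrite /eval /fvar mmapU /= scale1r mul1r /evalm fmU big_seq1. Qed.

Lemma rmorph_lie (R S : nzRingType) (h : {rmorphism R -> S}) x y :
  h (lie x y) = lie (h x) (h y).
Proof. by rewrite /lie rmorphB !rmorphM. Qed.

Lemma eval_lie (I : choiceType) (a : I -> A) f h :
  eval a (lie f h) = lie (eval a f) (eval a h).
Proof. exact: rmorph_lie. Qed.

Lemma eval_lie_left (I : choiceType) (a : I -> A) f s :
  eval a (lie_left f s) = lie_left (eval a f) (map (eval a) s).
Proof. by elim: s f => //= h s IH f; rewrite /lie_left /= -eval_lie; apply: IH. Qed.

Lemma eval_comm_prod (a : nat -> A) d :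
  eval a (comm_prod K d) = \prod_(i < d./2) lie (a i.*2) (a i.*2.+1).
Proof.
rewrite /comm_prod rmorph_prod; apply: eq_bigr => i _.
by rewrite [LHS]eval_lie !eval_fvar.
Qed.

Lemma spanned_eval (I : eqType) (g : I -> A) (J : choiceType) (a : J -> A) f :
  (forall j, spanned g predT (a j)) -> spanned g predT (eval a f).
Proof.
move=> ga; rewrite /eval mmapE; apply: spanned_sum => w.
rewrite -scalerAl mul1r; apply: spanned_scale; exact: spanned_prod.
Qed.

(** The kernel of an evaluation is a two-sided ideal, so only the generators of
    the commutator ideal matter. *)
Lemma eval_commutator_ideal (I : eqType) (g : I -> A) (a : nat -> A) p f :
    (forall u s, size s = p -> spanned g predT u ->
      (forall v, v \in s -> spanned g predT v) -> lie_left u s = 0) ->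
    (forall j, spanned g predT (a j)) ->
  commutator_ideal p.+1 f -> eval a f = 0.
Proof.
move=> nilp ga /(_ (fun h => eval a h = 0)); apply.
  split=> [|x y x0 y0|x y y0|x y y0]; first exact: rmorph0.
  - by rewrite rmorphB /= x0 y0 subrr.
  - by rewrite rmorphM /= y0 mulr0.
  - by rewrite rmorphM /= y0 mul0r.
move=> _ [u [s [[sz] ->]]]; rewrite eval_lie_left; apply: nilp.
- by rewrite size_map.
- exact: spanned_eval.
- by move=> _ /mapP[v _ ->]; apply: spanned_eval.
Qed.

End Evaluation.

(** The map [y] substitutes variables of F_n for those of the product of
    commutators.  The result is nonzero in F_n as soon as some evaluation [b]
    that kills the commutator ideal does not kill it. *)
Lemma comm_prod_not_identity (K : fieldType) (A : algType K)
    (b : nat -> A) n p (p_gt0 : (0 < p)%N) (y : nat -> 'I_n) d :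
    (forall f, commutator_ideal p.+1 f -> eval b f = 0) ->
    \prod_(i < d./2) lie (b (y i.*2)) (b (y i.*2.+1)) != 0 ->
  ~ is_identity (relfree K n p_gt0) (comm_prod K d).
Proof.
move=> bI /eqP neq0 idd; apply: neq0.
pose F := \prod_(i < d./2) lie (fvar K (y i.*2)) (fvar K (y i.*2.+1)).
have IF : relfree_ideal p F.
  (* [idd] is used where the variables take generic values in F_n *)
  rewrite -[F]subr0; apply/(quot_pi_eq (relfree_pideal K n p_gt0)).
  rewrite raddf0 -[RHS](idd (fun i => quot_pi _ (fvar K (y i)))) eval_comm_prod.
  rewrite rmorph_prod; apply: eq_bigr => i _; exact: rmorph_lie.
have incl_lie (i j : 'I_n) :
    freeAlg_incl (lie (fvar K i) (fvar K j)) = lie (fvar K (i : nat)) (fvar K (j : nat)).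
  by rewrite /freeAlg_incl eval_lie !eval_fvar.
have := bI _ IF; rewrite /freeAlg_incl !rmorph_prod => <-.
apply: eq_bigr => i _.
transitivity (eval b (lie (fvar K (y i.*2 : nat)) (fvar K (y i.*2.+1 : nat)))).
  by rewrite eval_lie !eval_fvar.
exact/esym/(congr1 (eval b) (incl_lie _ _)).
Qed.

(** * Points with a nonzero product of commutators *)

Lemma prod_pairs (R : nzRingType) (g : nat -> R) N :
  \prod_(j < N) (g j.*2 * g j.*2.+1) = \prod_(i < N.*2) g i.
Proof.
elim: N => [|N IH]; first by rewrite !big_ord0.
by rewrite doubleS !big_ord_recr /= IH mulrA.
Qed.

Section Points.
Variables (K : fieldType) (charK0 : [pchar K] =i pred0) (m q : nat).

(** The letters come in pairs [2j], [2j+1].  The pair [j < m] makes up the small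
    colour [j], and all other letters have the large colour [m]. *)
Definition colour (i : nat) : 'I_m.+1 := inord (minn i./2 m).

Lemma colourE i : colour i = minn i./2 m :> nat.
Proof. by rewrite /colour inordK //; lia. Qed.

Lemma few_letters (c : 'I_m.+1) (w : seq nat) :
  c != ord_max -> uniq w -> (count (fun i => colour i == c) w <= 2)%N.
Proof.
move=> c_max uw; have cm : (c < m)%N.
  by move: c_max; rewrite -val_eqE /=; have := ltn_ord c; lia.
rewrite -size_filter; apply: (@uniq_leq_size _ _ [:: c.*2; c.*2.+1]).
  exact: filter_uniq.
move=> i; rewrite mem_filter !inE => /andP[/eqP ic _].
by move: (colourE i); rewrite ic; lia.
Qed.

Variables (A : algType K) (g : nat -> A).
Hypothesis g_comm :
  forall i j, g i * g j = (-1) ^+ (colour i == colour j) * (g j * g i).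

(** The points [0] and [1] contain one letter of each colour, so that their
    commutator involves every colour. *)
Definition point (i : nat) : A :=
  if (i < 2)%N then \sum_(j < m.+1) g (j.*2 + i) else g (m.*2 + i).

Let two_unit : 2%:R != 0 :> K.
Proof. by rewrite (proj1 (pcharf0P K) charK0). Qed.

Let Y j := lie (g j.*2) (g j.*2.+1).

Let colour_pair j : colour j.*2 = colour j.*2.+1.
Proof. by apply: val_inj; rewrite /= !colourE; lia. Qed.

Let YE j : Y j = 2%:R *: word g [:: j.*2; j.*2.+1].
Proof.
rewrite /Y /lie /word !big_cons big_nil mulr1 [g _.+1 * _]g_comm colour_pair eqxx.
by rewrite expr1 mulN1r opprK scaler_nat.
Qed.

Let Y_comm i j : Y i * Y j = Y j * Y i.
Proof.
rewrite !YE -!scalerAl -!scalerAr (word_comm g_comm) -signr_odd.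
suff /negPf-> : ~~ odd (crossings colour [:: i.*2; i.*2.+1] [:: j.*2; j.*2.+1]).
  by rewrite mul1r.
rewrite /crossings; elim/big_ind: _ => // [x y|c _].
  by rewrite oddD => /negPf-> /negPf->.
by rewrite /= !colour_pair; do 2?case: eqP.
Qed.

Let Y_sq j : Y j * Y j = 0.
Proof.
rewrite YE -scalerAl -scalerAr -word_cat (word_nonuniq two_unit g_comm) ?scaler0 //.
by rewrite /= !inE eqxx orbT.
Qed.

(** The cross terms vanish since letters of different colours commute. *)
Let lie_point01 : lie (point 0) (point 1) = \sum_(j < m.+1) Y j.
Proof.
rewrite /lie /point /= mulr_suml mulr_sumr -sumrB; apply: eq_bigr => j _.
rewrite mulr_sumr mulr_suml -sumrB (bigD1 j) //= addn0 addn1 big1 ?addr0 //.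
move=> l l_neq; rewrite addn1 g_comm.
suff /negPf-> : colour j.*2 != colour l.*2.+1 by rewrite mul1r subrr.
rewrite -val_eqE /= !colourE; move: l_neq; rewrite -val_eqE /=.
by have := ltn_ord j; have := ltn_ord l; lia.
Qed.

(** By truncated subtraction the commutator of the points [0] and [1] occurs for
    all [k <= m], that is [m + 1] times, and its power is evaluated by
    [sum_sq0_expr].  The commutator of the points [2(k - m)] and [2(k - m) + 1]
    is [Y k] for [k > m], so that each letter occurs exactly once. *)
Lemma point_comm_prod : (0 < q)%N ->
  \prod_(k < q + m) lie (point (k - m).*2) (point (k - m).*2.+1) =
    (m.+1`! * 2 ^ (q + m))%:R *: \prod_(i < (q + m).*2) g i.
Proof.
move=> q_gt0.
rewrite -(big_mkord xpredT (fun k => lie (point (k - m).*2) (point (k - m).*2.+1))).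
rewrite (big_cat_nat (n := m.+1)) //=; last by lia.
rewrite (@eq_big_nat _ _ _ 0 _ _ (fun=> lie (point 0) (point 1))); last first.
  by move=> k /andP[_ km]; have -> : (k - m = 0)%N by lia.
rewrite big_mkord prodr_const card_ord lie_point01.
have -> : (\sum_(j < m.+1) Y j) ^+ m.+1 = (\prod_(0 <= j < m.+1) Y j) *+ m.+1`!.
  have [||] := @sum_sq0_expr A (map Y (index_iota 0 m.+1)).
  - by move=> _ _ /mapP[i _ ->] /mapP[j _ ->].
  - by move=> _ /mapP[i _ ->].
  by rewrite !big_map size_map size_iota subn0 big_mkord => ->.
rewrite (@eq_big_nat _ _ _ m.+1 _ _ Y); last first.
  have point_ge2 i : (1 < i)%N -> point i = g (m.*2 + i).
    by move=> i_gt1; rewrite /point ltnNge i_gt1.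
  move=> k /andP[mk _]; rewrite !point_ge2; try by lia.
  by congr (lie (g _) (g _)); lia.
rewrite mulrnAl -big_cat_nat //=; last by lia.
rewrite big_mkord -prod_pairs natrM -scalerA natrX
  -[X in _ ^+ X]card_ord -prodr_const scaler_nat.
rewrite -scaler_prod; congr (_ *+ _); apply: eq_bigr => j _.
by rewrite YE /word !big_cons big_nil mulr1.
Qed.

Lemma point_comm_prod_neq0 : (0 < q)%N -> \prod_(i < (q + m).*2) g i != 0 ->
  \prod_(k < q + m) lie (point (k - m).*2) (point (k - m).*2.+1) != 0.
Proof.
move=> q_gt0 g_neq0; rewrite point_comm_prod // scaler_eq0 negb_or g_neq0 andbT.
by rewrite (proj1 (pcharf0P K) charK0) muln_eq0 negb_or -!lt0n fact_gt0 expn_gt0.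
Qed.

Lemma spanned_point i : spanned g predT (point i).
Proof.
have gi j : spanned g predT (g j).
  by rewrite -[g j](big_seq1 *%R j g); apply: spanned_word.
by rewrite /point; case: ifP => // _; apply: spanned_sum.
Qed.

Lemma eval_point p f : (m.*2.+2 <= p)%N -> commutator_ideal p.+1 f -> eval point f = 0.
Proof.
move=> mp; apply: (@eval_commutator_ideal _ _ _ g); last exact: spanned_point.
move=> u s sz gu gs.
apply: (lie_left_eq0 two_unit g_comm few_letters) => //.
by rewrite card_ord sz.
Qed.

End Points.

(** * The theorem *)

Lemma relfree_not_identity (K : fieldType) (charK0 : [pchar K] =i pred0)
    (n p m q : nat) (p_gt0 : (0 < p)%N) :
    (0 < q)%N -> (q.*2 <= n)%N -> (m.*2.+2 <= p)%N ->
  ~ is_identity (relfree K n p_gt0) (comm_prod K (q + m).*2).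
Proof.
case: n => [|n] q_gt0 qn mp; first by lia.
have [|A [g [g_comm g_neq0]]] :=
    @colour_algebra K (fun i j => colour m i == colour m j) (q + m).*2.
  by move=> i j; apply: eq_sym.
(* the first two of the n variables are reused in m + 1 commutators *)
pose y i : 'I_n.+1 := inord ((i./2 - m).*2 + odd i).
apply: (comm_prod_not_identity (y := y) (b := point m g)).
  by move=> f; apply: eval_point.
rewrite doubleK; have := point_comm_prod_neq0 charK0 g_comm q_gt0 g_neq0.
congr (_ != _); apply: eq_bigr => k _; have := ltn_ord k => kqm.
by rewrite /y !inordK; try lia; congr (lie (point _ _ _) (point _ _ _)); lia.
Qed.

Lemma comm_prod0_not_identity (K : fieldType) (A : algType K) :
  ~ is_identity A (comm_prod K 0).
Proof.
move=> /(_ (fun=> 0)); rewrite eval_comm_prod big_ord0 => /eqP.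
by rewrite oner_eq0.
Qed.

Local Close Scope ring_scope.

Theorem proposition5p1 (K : fieldType) (charK0 : [pchar K]%R =i pred0)
    (n p : nat) (n_gt0 : 0 < n) (p_gt0 : 0 < p)
    (n1_p : n = 1 -> p <= 3) (p1_n : p = 1 -> n <= 3) :
  [/\ odd n != odd p ->
        ~ is_identity (relfree K n p_gt0) (comm_prod K (n + p - 3)),
      odd n && odd p ->
        ~ is_identity (relfree K n p_gt0) (comm_prod K (n + p - 4))
    & ~~ odd n && ~~ odd p ->
        ~ is_identity (relfree K n p_gt0) (comm_prod K (n + p - 2))].
Proof.
(* degenerate parameters leave the empty product *)
suff main d : (1 < n /\ 1 < p /\ d = (n./2 + p./2.-1).*2) \/ d = 0 ->
    ~ is_identity (relfree K n p_gt0) (comm_prod K d).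
  by split=> par; apply: main; lia.
case=> [[n_gt1 [p_gt1 ->]]|->]; last exact: comm_prod0_not_identity.
by apply: relfree_not_identity => //; lia.
Qed.
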